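(* Let $\alpha\neq 0$ and $\delta$ be real constants and let $(M,\varphi_i,\xi_i,\eta_i,g)$, $i=1,2,3$, be a $3$-$(\alpha,\delta)$-Sasaki manifold, i.e. an almost $3$-contact metric manifold satisfying $d\eta_i=2\alpha\Phi_i+2(\alpha-\delta)\,\eta_j\wedge\eta_k$ for every even permutation $(i,j,k)$ of $(1,2,3)$. Then $M$ is hypernormal, i.e. $N_{\varphi_1}=N_{\varphi_2}=N_{\varphi_3}=0$.
   Context: An almost contact metric structure $(\varphi,\xi,\eta,g)$ on a manifold consists of a $(1,1)$-tensor field $\varphi$, a vector field $\xi$, a $1$-form $\eta$ and a Riemannian metric $g$ with $\varphi^2=-I+\eta\otimes\xi$, $\eta(\xi)=1$, $g(\varphi X,\varphi Y)=g(X,Y)-\eta(X)\eta(Y)$. Its fundamental $2$-form is $\Phi(X,Y)=g(X,\varphi Y)$, and $N_\varphi(X,Y)=[\varphi X,\varphi Y]+\varphi^2[X,Y]-\varphi[\varphi X,Y]-\varphi[X,\varphi Y]+d\eta(X,Y)\xi$. An almost $3$-contact metric manifold $(M,\varphi_i,\xi_i,\eta_i,g)$, $i=1,2,3$, is a manifold of dimension $4n+3$ with three almost contact metric structures with the same metric $g$ such that, for every even permutation $(i,j,k)$ of $(1,2,3)$, $\varphi_k=\varphi_i\varphi_j-\eta_j\otimes\xi_i=-\varphi_j\varphi_i+\eta_i\otimes\xi_j$, $\xi_k=\varphi_i\xi_j=-\varphi_j\xi_i$, $\eta_k=\eta_i\circ\varphi_j=-\eta_j\circ\varphi_i$. $\Phi_i$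 is the fundamental $2$-form of the $i$-th structure. Conventions: $d\eta(X,Y)=X(\eta(Y))-Y(\eta(X))-\eta([X,Y])$ and $(\eta\wedge\zeta)(X,Y)=\eta(X)\zeta(Y)-\eta(Y)\zeta(X)$. *)

(* Defs.v *)
From HB Require Import structures.
From mathcomp Require Import ring.
From mathcomp Require Import all_boot all_order all_algebra all_fingroup.
From mathcomp Require Import all_classical all_reals all_analysis.

Set Implicit Arguments.
Unset Strict Implicit.
Unset Printing Implicit Defensive.

Import Order.TTheory GRing.Theory Num.Theory.
Import numFieldTopology.Exports numFieldNormedType.Exports.

Local Open Scope classical_set_scope.
Local Open Scope ring_scope.

Section SmoothEuclidean.
Context {R : realType} {m : nat}.
Implicit Types (U : set 'rV[R]_m) (f g : 'rV[R]_m -> R^o).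

(* f is of class C^k on the open set U; values of f outside U are irrelevant. *)
Fixpoint Ck_on U (k : nat) f : Prop :=
  (forall x, U x -> {for x, continuous f}) /\
  if k is k'.+1 then
    forall i : 'I_m, (forall x, U x -> derivable f x (delta_mx 0 i)) /\
                     Ck_on U k' (fun x => 'D_(delta_mx 0 i) f x)
  else True.

Definition smooth_on U f : Prop := forall k, Ck_on U k f.

Lemma Ck_on_eq U k f g : open U -> (forall x, U x -> f x = g x) ->
  Ck_on U k f -> Ck_on U k g.
Proof.
move=> oU.
have fgn f1 g1 (e : forall x, U x -> f1 x = g1 x) x : U x -> \near x, f1 x = g1 x.
  move=> Ux; have : nbhs x U by exact: open_nbhs_nbhs.
  by apply: filterS => y /e.
have cont f1 g1 : (forall x, U x -> f1 x = g1 x) ->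
    (forall x, U x -> {for x, continuous f1}) ->
    forall x, U x -> {for x, continuous g1}.
  move=> e cf x Ux; rewrite /prop_for /continuous_at -(e x Ux).
  apply: cvg_trans (cf x Ux); apply: (@near_eq_cvg _ _ (nbhs x)).
  by apply: (filterS _ (fgn _ _ e x Ux)) => y ->.
elim: k f g => [|k IH] f g fg /= [cf df]; split=> //; try exact: cont fg cf.
move=> i; have [d1 d2] := df i; split.
  by move=> x Ux; apply: near_eq_derivable (d1 x Ux); exact: fgn.
by apply: IH d2 => x Ux; apply: near_eq_derive; exact: fgn.
Qed.

Lemma Ck_on_cst U k (c : R^o) : Ck_on U k (cst c).
Proof.
have cc a : forall x, U x -> {for x, continuous (cst a : 'rV[R]_m -> R^o)}.
  by move=> x _; exact: cst_continuous.
elim: k c => [|k IH] c; split=> //; first exact: cc.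
  exact: cc.
move=> i; split=> [x _|]; first exact: derivable_cst.
rewrite (_ : (fun x => _) = cst 0); first exact: IH.
by apply/funext => x; rewrite derive_cst.
Qed.

Lemma Ck_onS U k f : Ck_on U k.+1 f -> Ck_on U k f.
Proof.
elim: k f => [|k IH] f; first by case.
by move=> [cf df]; split=> // i; have [d1 d2] := df i; split=> //; exact: IH.
Qed.

Lemma Ck_onD U k f g : open U ->
  Ck_on U k f -> Ck_on U k g -> Ck_on U k (f + g).
Proof.
move=> oU; elim: k f g => [|k IH] f g [cf df] [cg dg]; split=> //;
  try by move=> x Ux; apply: continuousD; [exact: cf|exact: cg].
move=> i; have [f1 f2] := df i; have [g1 g2] := dg i; split.
  by move=> x Ux; apply: derivableD; [exact: f1|exact: g1].
apply: Ck_on_eq (IH _ _ f2 g2) => // x Ux.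
by rewrite deriveD //; [exact: f1|exact: g1].
Qed.

Lemma Ck_onM U k f g : open U ->
  Ck_on U k f -> Ck_on U k g -> Ck_on U k (f * g).
Proof.
move=> oU; elim: k f g => [|k IH] f g Cf Cg.
  move: Cf Cg => [cf _] [cg _]; split=> // x Ux.
  by apply: continuousM; [exact: cf|exact: cg].
have [[cf df] [cg dg]] := (Cf, Cg); split.
  by move=> x Ux; apply: continuousM; [exact: cf|exact: cg].
move=> i; have [f1 f2] := df i; have [g1 g2] := dg i; split.
  by move=> x Ux; apply: derivableM; [exact: f1|exact: g1].
apply: Ck_on_eq (Ck_onD oU (IH _ _ (Ck_onS Cf) g2) (IH _ _ (Ck_onS Cg) f2)) => //.
by move=> x Ux; rewrite deriveM //; [exact: f1|exact: g1].
Qed.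

End SmoothEuclidean.

(* A chart of dimension m: a homeomorphism from the open set [chart_dom] onto *)
(* the open set [chart_cod]; both maps are total functions whose values       *)
(* outside these sets are irrelevant.                                         *)
Record chart (R : realType) (m : nat) (T : topologicalType) := Chart {
  chart_dom : set T;
  chart_map :> T -> 'rV[R]_m;
  chart_inv : 'rV[R]_m -> T;
  chart_cod := chart_map @` chart_dom;
  chart_dom_open : open chart_dom;
  chart_cod_open : open chart_cod;
  chart_mapK : forall p, chart_dom p -> chart_inv (chart_map p) = p;
  chart_map_continuous :
    forall p, chart_dom p -> {for p, continuous chart_map};
  chart_inv_continuous :
    forall x, chart_cod x -> {for x, continuous chart_inv}
}.

Definition chart_compatible R m T (c d : chart R m T) : Prop :=
  forall i : 'I_m, smooth_on (c @` (chart_dom c `&` chart_dom d))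
                             (fun x => d (chart_inv c x) 0 i).

Record smooth_manifold (R : realType) (m : nat) := SmoothManifold {
  man_sort :> topologicalType;
  atlas : set (chart R m man_sort);
  man_hausdorff : hausdorff_space man_sort;
  man_second_countable : @second_countable man_sort;
  atlas_cover : forall p, exists2 c, atlas c & chart_dom c p;
  atlas_compatible : forall c d, atlas c -> atlas d -> chart_compatible c d
}.

Section SmoothFunctions.
Context {R : realType} {m : nat} (M : smooth_manifold R m).

Definition smooth_fun : {pred M -> R^o} := fun f =>
  `[< forall c, atlas c -> smooth_on (chart_cod c) (f \o chart_inv c) >].

Lemma smooth_fun_subring : subring_closed smooth_fun.
Proof.
have C1 (a : R) : cst a \in smooth_fun.
  by apply/asboolP => c _ k; exact: (Ck_on_cst _ k a).
have CM : {in smooth_fun &, forall f g, f * g \in smooth_fun}.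
  move=> f g /asboolP sf /asboolP sg; apply/asboolP => c ac k.
  by apply: Ck_onM (sf c ac k) (sg c ac k); exact: chart_cod_open.
split; [exact: C1| |exact: CM] => f g sf sg.
have /asboolP sNg : cst (-1) * g \in smooth_fun by exact: CM.
move/asboolP: sf => sf; apply/asboolP => c ac k.
have := Ck_onD (@chart_cod_open _ _ _ c) (sf c ac k) (sNg c ac k).
apply: Ck_on_eq; first exact: chart_cod_open.
by move=> x _ /=; rewrite !fctE /= mulN1r.
Qed.
HB.instance Definition _ :=
  GRing.isSubringClosed.Build (M -> R^o) smooth_fun smooth_fun_subring.

Lemma smooth_fun_scale : GRing.scaler_closed smooth_fun.
Proof.
move=> a f /asboolP sf; apply/asboolP => c ac k.
exact: Ck_onM (@chart_cod_open _ _ _ c) (Ck_on_cst _ k a) (sf c ac k).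
Qed.
HB.instance Definition _ :=
  GRing.isScaleClosed.Build R (M -> R^o) smooth_fun smooth_fun_scale.

Record cinf := CInf { cinf_fun :> M -> R^o; _ : cinf_fun \in smooth_fun }.
HB.instance Definition _ := [isSub for cinf_fun].
HB.instance Definition _ := [Choice of cinf by <:].
HB.instance Definition _ :=
  GRing.SubChoice_isSubComPzRing.Build _ _ cinf (subringClosedP smooth_fun).
HB.instance Definition _ := [SubZmodule_isSubLmodule of cinf by <:].

(* The tangent space at p is the space of point derivations at p of the       *)
(* algebra of smooth functions.                                               *)
Definition point_derivation (p : M) : {pred cinf -> R^o} := fun v =>
  `[< linear v /\ forall f g : cinf, v (f * g) = f p * v g + g p * v f >].

Lemma point_derivation_submod p : submod_closed (point_derivation p).
Proof.
split.
  apply/asboolP; have z h : (0 : cinf -> R^o) h = 0 by [].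
  by split=> [a f g|f g]; rewrite !z ?scaler0 ?mulr0 addr0.
move=> a v w /asboolP [vl vM] /asboolP [wl wM]; apply/asboolP.
have E h : (a *: v + w) h = a * v h + w h by [].
split=> [b f g|f g]; rewrite !E.
  by rewrite vl wl /GRing.scale /=; ring.
by rewrite vM wM; ring.
Qed.
HB.instance Definition _ p :=
  GRing.isSubmodClosed.Build R (cinf -> R^o) (point_derivation p)
    (point_derivation_submod p).

Record tangent (p : M) := Tangent {
  tangent_fun :> cinf -> R^o;
  _ : tangent_fun \in point_derivation p }.
HB.instance Definition _ p := [isSub for @tangent_fun p].
HB.instance Definition _ p := [Choice of tangent p by <:].
HB.instance Definition _ p := [SubChoice_isSubLmodule of tangent p by <:].

(* Smoothness of a field of tangent vectors, covectors, endomorphisms or      *)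
(* bilinear forms is tested on global smooth functions and vector fields,     *)
(* which on a manifold is equivalent to smoothness of its components.         *)
Record vector_field := VectorField {
  vf_at :> forall p, tangent p;
  vf_smooth : forall f : cinf, (fun p => vf_at p f) \in smooth_fun }.

Definition lie_derivative (X : vector_field) (f : cinf) : cinf :=
  CInf (vf_smooth X f).

Lemma lie_bracket_derivation (X Y : vector_field) (p : M) :
  (fun f => X p (lie_derivative Y f) - Y p (lie_derivative X f))
    \in point_derivation p.
Proof.
have lin (Z : vector_field) q : linear (Z q).
  by case: (Z q) => v /= /asboolP [].
have leib (Z : vector_field) q (f g : cinf) :
    Z q (f * g) = f q * Z q g + g q * Z q f.
  by case: (Z q) => v /= /asboolP [].
have LL (Z : vector_field) a (f g : cinf) :
    lie_derivative Z (a *: f + g) = a *: lie_derivative Z f + lie_derivative Z g.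
  by apply/val_inj/funext => q /=; rewrite lin.
have LM (Z : vector_field) (f g : cinf) :
    lie_derivative Z (f * g) = f * lie_derivative Z g + g * lie_derivative Z f.
  by apply/val_inj/funext => q /=; rewrite leib.
have add (Z : vector_field) q (f g : cinf) : Z q (f + g) = Z q f + Z q g.
  by rewrite -[f in LHS]scale1r lin scale1r.
apply/asboolP; split=> [a f g|f g].
  by rewrite !LL !lin scalerBr opprD addrACA.
rewrite !LM !add !leib /= !mulrBr !opprD.
set a := f p * _; set b := g p * _; set c := f p * _; set d := g p * _.
rewrite [Y p f * _]mulrC [Y p g * _]mulrC.
set e := X p g * _; set h := X p f * _.
by rewrite !addrA; ring.
Qed.

Lemma lie_bracket_smooth (X Y : vector_field) (f : cinf) :
  (fun p => Tangent (lie_bracket_derivation X Y p) f) \in smooth_fun.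
Proof.
exact: (valP (lie_derivative X (lie_derivative Y f) -
              lie_derivative Y (lie_derivative X f))).
Qed.

Definition lie_bracket (X Y : vector_field) : vector_field :=
  VectorField (lie_bracket_smooth X Y).

Record one_form := OneForm {
  form_at :> forall p, {linear tangent p -> R^o};
  form_smooth :
    forall X : vector_field, (fun p => form_at p (X p)) \in smooth_fun }.

Record endo_field := EndoField {
  endo_at :> forall p, {linear tangent p -> tangent p};
  endo_smooth : forall (X : vector_field) (f : cinf),
    (fun p => endo_at p (X p) f) \in smooth_fun }.

Definition form_app (eta : one_form) (X : vector_field) : cinf :=
  CInf (form_smooth eta X).

Definition endo_app (phi : endo_field) (X : vector_field) : vector_field :=
  VectorField (endo_smooth phi X).

(* Linearity in the first argument follows from symmetry.                     *)
Record riemannian_metric := RiemannianMetric {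
  metric_at :> forall p, tangent p -> tangent p -> R^o;
  metric_linear : forall p (u : tangent p), linear (@metric_at p u);
  metric_sym : forall p (u v : tangent p), @metric_at p u v = @metric_at p v u;
  metric_pos : forall p (u : tangent p), u != 0 -> 0 < @metric_at p u u;
  metric_smooth : forall X Y : vector_field,
    (fun p => @metric_at p (X p) (Y p)) \in smooth_fun }.

Definition ext_deriv (eta : one_form) (X Y : vector_field) (p : M) : R :=
  X p (form_app eta Y) - Y p (form_app eta X) - eta p (lie_bracket X Y p).

Definition wedge (eta zeta : one_form) (X Y : vector_field) (p : M) : R :=
  eta p (X p) * zeta p (Y p) - eta p (Y p) * zeta p (X p).

Record almost_contact_metric (g : riemannian_metric) := AlmostContactMetric {
  acm_phi : endo_field;
  acm_xi : vector_field;
  acm_eta : one_form;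
  acm_phi2 : forall p (u : tangent p),
    acm_phi p (acm_phi p u) = - u + acm_eta p u *: acm_xi p;
  acm_eta_xi : forall p, acm_eta p (acm_xi p) = 1;
  acm_metric : forall p (u v : tangent p),
    g p (acm_phi p u) (acm_phi p v) = g p u v - acm_eta p u * acm_eta p v }.

Definition fundamental_form g (S : almost_contact_metric g)
    (X Y : vector_field) (p : M) : R :=
  g p (X p) (acm_phi S p (Y p)).

Definition nijenhuis g (S : almost_contact_metric g)
    (X Y : vector_field) (p : M) : tangent p :=
  let phi := acm_phi S in
  lie_bracket (endo_app phi X) (endo_app phi Y) p
  + phi p (phi p (lie_bracket X Y p))
  - phi p (lie_bracket (endo_app phi X) Y p)
  - phi p (lie_bracket X (endo_app phi Y) p)
  + ext_deriv (acm_eta S) X Y p *: acm_xi S p.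

End SmoothFunctions.

(* (i, j, k) is an even permutation of the indices; 1, 2, 3 are encoded as    *)
(* 0, 1, 2 : 'I_3.                                                            *)
Definition even_triple (i j k : 'I_3) : Prop :=
  exists s : 'S_3, [/\ ~~ odd_perm s, i = s 0, j = s 1 & k = s 2].

Record almost_3_contact_metric (R : realType) (n : nat)
    (M : smooth_manifold R (4 * n + 3)%N) := Almost3ContactMetric {
  a3c_metric : riemannian_metric M;
  a3c_str :> 'I_3 -> almost_contact_metric a3c_metric;
  a3c_phi1 : forall i j k, even_triple i j k -> forall p (u : tangent p),
    acm_phi (a3c_str k) p u =
    acm_phi (a3c_str i) p (acm_phi (a3c_str j) p u)
    - acm_eta (a3c_str j) p u *: acm_xi (a3c_str i) p;
  a3c_phi2 : forall i j k, even_triple i j k -> forall p (u : tangent p),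
    acm_phi (a3c_str k) p u =
    - acm_phi (a3c_str j) p (acm_phi (a3c_str i) p u)
    + acm_eta (a3c_str i) p u *: acm_xi (a3c_str j) p;
  a3c_xi1 : forall i j k, even_triple i j k -> forall p,
    acm_xi (a3c_str k) p = acm_phi (a3c_str i) p (acm_xi (a3c_str j) p);
  a3c_xi2 : forall i j k, even_triple i j k -> forall p,
    acm_xi (a3c_str k) p = - acm_phi (a3c_str j) p (acm_xi (a3c_str i) p);
  a3c_eta1 : forall i j k, even_triple i j k -> forall p (u : tangent p),
    acm_eta (a3c_str k) p u =
    acm_eta (a3c_str i) p (acm_phi (a3c_str j) p u);
  a3c_eta2 : forall i j k, even_triple i j k -> forall p (u : tangent p),
    acm_eta (a3c_str k) p u =
    - acm_eta (a3c_str j) p (acm_phi (a3c_str i) p u) }.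

Definition alpha_delta_sasaki (R : realType) (n : nat)
    (M : smooth_manifold R (4 * n + 3)%N) (S : almost_3_contact_metric M)
    (alpha delta : R) : Prop :=
  forall i j k, even_triple i j k -> forall (X Y : vector_field M) (p : M),
    ext_deriv (acm_eta (S i)) X Y p =
    2 * alpha * fundamental_form (S i) X Y p
    + 2 * (alpha - delta) * wedge (acm_eta (S j)) (acm_eta (S k)) X Y p.

Definition hypernormal (R : realType) (n : nat)
    (M : smooth_manifold R (4 * n + 3)%N) (S : almost_3_contact_metric M) : Prop :=
  forall (i : 'I_3) (X Y : vector_field M) (p : M), nijenhuis (S i) X Y p = 0.

(* Main.v *)
(* Hitchin's argument that an almost hyperhermitian structure with closed     *)
(* Kaehler forms is integrable, adapted to the exact forms                    *)
(* omega_a := d eta_a. Fix an even permutation (i, j, k), write J := phi_i,   *)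
(* and put Omega := omega_j + sqrt(-1) omega_k, A := X + sqrt(-1) J X,        *)
(* B := Y + sqrt(-1) J Y. The contraction of Omega with A is                  *)
(* -2 sqrt(-1) delta eta_i(X) (eta_j + sqrt(-1) eta_k), and the 1-form        *)
(* eta_j + sqrt(-1) eta_k vanishes on A, on B, on horizontal vector fields Z  *)
(* (those killed by all three eta_a) and on [A, Z] and [B, Z]. Hence          *)
(* d Omega (A, B, Z) = 0 reduces to Omega([A, B], Z) = 0. As                  *)
(* omega_a(W, Z) = 2 alpha g(W, phi_a Z) for Z horizontal and alpha <> 0, the *)
(* real part of this says that the horizontal part of N_{phi_i}(X, Y)         *)
(* vanishes. Its vertical components eta_a(N_{phi_i}(X, Y)) are computed      *)
(* directly from the definition of d eta_a.                                   *)

Require Import Defs.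
From mathcomp Require Import ring lra.
From mathcomp Require Import all_boot all_order all_algebra all_fingroup.
From mathcomp Require Import all_classical all_reals all_analysis.

Set Implicit Arguments.
Unset Strict Implicit.
Unset Printing Implicit Defensive.

Import Order.TTheory GRing.Theory Num.Theory.
Local Open Scope ring_scope.

(** Put theta := eta_j + sqrt(-1) eta_k, so d theta = Omega. Complex identities are carried by real
    and imaginary parts: [omega_jB_kJ] and [omega_jJ_Dk] contract Omega with A, [ext_deriv_closed]
    gives d Omega = 0, and [omega_bracketJ_horizontal] is Re Omega([A, B], Z) = 0. [nijenhuis_eq0]
    builds Z from N := N_{phi_i}(X, Y) itself, so no tangent vector has to be extended to a
    field. *)

Section Calculus.
Context {R : realType} {m : nat} {M : smooth_manifold R m}.
Implicit Types (p : M) (X Y Z : vector_field M).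
Implicit Types (eta : one_form M) (f h : cinf M).

(** * Brackets, one-forms and d(d eta) = 0 *)

Lemma tangentDE p (u v : tangent p) f : (u + v) f = u f + v f.
Proof. by []. Qed.

Lemma tangentNE p (u : tangent p) f : (- u) f = - u f.
Proof. by []. Qed.

Lemma tangent_eqP p (u v : tangent p) : (forall f, u f = v f) -> u = v.
Proof. by move=> uv; apply/val_inj/funext. Qed.

Lemma tangent_linear p (u : tangent p) : linear u.
Proof. by case: u => u /= /asboolP []. Qed.

Lemma tangentD p (u : tangent p) f h : u (f + h) = u f + u h.
Proof. by rewrite -[f in LHS]scale1r tangent_linear scale1r. Qed.

Lemma tangent0 p (u : tangent p) : u 0 = 0.
Proof. by apply: (addrI (u 0)); rewrite -tangentD !addr0. Qed.

Lemma tangentN p (u : tangent p) f : u (- f) = - u f.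
Proof. by apply: (addrI (u f)); rewrite -tangentD !subrr tangent0. Qed.

Lemma cinf_eqP f h : (forall p, f p = h p) -> f = h.
Proof. by move=> fh; apply/val_inj/funext. Qed.

Lemma lie_bracketE X Y p f :
  lie_bracket X Y p f = X p (lie_derivative Y f) - Y p (lie_derivative X f).
Proof. by []. Qed.

Lemma lie_bracketC X Y p : lie_bracket X Y p = - lie_bracket Y X p.
Proof. by apply: tangent_eqP => f; rewrite tangentNE !lie_bracketE opprB. Qed.

Lemma lie_derivative_bracket X Y f :
  lie_derivative (lie_bracket X Y) f =
  lie_derivative X (lie_derivative Y f) - lie_derivative Y (lie_derivative X f).
Proof. exact: cinf_eqP. Qed.

Lemma lie_bracket_jacobi X Y Z p :
  lie_bracket (lie_bracket X Y) Z p + lie_bracket (lie_bracket Y Z) X p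
  + lie_bracket (lie_bracket Z X) Y p = 0.
Proof.
apply: tangent_eqP => f; rewrite !tangentDE !lie_bracketE.
rewrite !lie_derivative_bracket !tangentD !tangentN.
rewrite [RHS](_ : _ = 0 :> R) //; ring.
Qed.

Definition ext_deriv_fun eta X Y : cinf M :=
  lie_derivative X (form_app eta Y) - lie_derivative Y (form_app eta X)
  - form_app eta (lie_bracket X Y).

Lemma ext_deriv_funE eta X Y p : ext_deriv_fun eta X Y p = ext_deriv eta X Y p.
Proof. by []. Qed.

Lemma ext_derivC eta X Y p : ext_deriv eta X Y p = - ext_deriv eta Y X p.
Proof.
by rewrite /ext_deriv lie_bracketC linearN /=; ring.
Qed.

Lemma ext_deriv_funC eta X Y : ext_deriv_fun eta X Y = - ext_deriv_fun eta Y X.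
Proof. by apply: cinf_eqP => p; exact: ext_derivC. Qed.

Lemma form_bracket eta X Y p :
  eta p (lie_bracket X Y p) =
  X p (form_app eta Y) - Y p (form_app eta X) - ext_deriv eta X Y p.
Proof. by rewrite /ext_deriv; ring. Qed.

Lemma formD eta p (u v : tangent p) : eta p (u + v) = eta p u + eta p v.
Proof. exact: linearD. Qed.

Lemma formN eta p (u : tangent p) : eta p (- u) = - eta p u.
Proof. exact: linearN. Qed.

Lemma formZ eta p (a : R) (u : tangent p) : eta p (a *: u) = a * eta p u.
Proof. exact: linearZ. Qed.

(** The invariant formula for d(d eta) = 0: the two sides differ by eta of the Jacobi sum. *)
Lemma ext_deriv_closed eta X Y Z p :
  X p (ext_deriv_fun eta Y Z) + Y p (ext_deriv_fun eta Z X)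
  + Z p (ext_deriv_fun eta X Y) =
  ext_deriv eta (lie_bracket X Y) Z p + ext_deriv eta (lie_bracket Y Z) X p
  + ext_deriv eta (lie_bracket Z X) Y p.
Proof.
have := congr1 (eta p) (lie_bracket_jacobi X Y Z p).
rewrite !linearD linear0 /= => J.
rewrite /ext_deriv /ext_deriv_fun !tangentD !tangentN !lie_bracketE.
apply/eqP; rewrite -subr_eq0 -[X in _ == X]J; apply/eqP.
by ring.
Qed.

End Calculus.

(** * Algebra of one almost contact metric structure *)

Section AlmostContact.
Context {R : realType} {m : nat} {M : smooth_manifold R m}.
Context {g : riemannian_metric M} (S : almost_contact_metric g) {p : M}.
Local Notation phi := (acm_phi S p).
Local Notation xi := (acm_xi S p).
Local Notation eta := (acm_eta S p).
Implicit Types u v w : tangent p.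

Lemma metricDr u v w : g p u (v + w) = g p u v + g p u w.
Proof. by rewrite -[v in LHS]scale1r metric_linear scale1r. Qed.

Lemma metric0r u : g p u 0 = 0.
Proof. by apply: (addrI (g p u 0)); rewrite -metricDr !addr0. Qed.

Lemma metricZr u (a : R) v : g p u (a *: v) = a * g p u v.
Proof. by rewrite -[a *: v]addr0 metric_linear metric0r addr0. Qed.

Lemma metricNr u v : g p u (- v) = - g p u v.
Proof. by rewrite -scaleN1r metricZr mulN1r. Qed.

Lemma metricDl u v w : g p (u + v) w = g p u w + g p v w.
Proof. by rewrite !(Defs.metric_sym g _ w) metricDr. Qed.

Lemma metricZl (a : R) u v : g p (a *: u) v = a * g p u v.
Proof. by rewrite !(Defs.metric_sym g _ v) metricZr. Qed.

Lemma metricNl u v : g p (- u) v = - g p u v.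
Proof. by rewrite !(Defs.metric_sym g _ v) metricNr. Qed.

Lemma acm_xi_neq0 : xi != 0.
Proof.
apply/eqP => xi0; have := acm_eta_xi S p.
by rewrite xi0 linear0 => /eqP; rewrite eq_sym oner_eq0.
Qed.

(** Since phi^2 xi = 0, expanding phi^2 (phi xi) = 0 gives phi xi = a xi with a = eta(phi xi); then
    a^2 xi = phi^2 xi = 0. *)
Lemma acm_phi_xi : phi xi = 0.
Proof.
have phi2 : phi (phi xi) = 0 by rewrite acm_phi2 acm_eta_xi scale1r addNr.
have := acm_phi2 S (phi xi); rewrite phi2 linear0.
move/esym/eqP; rewrite addrC subr_eq0; set a := acm_eta S p _ => /eqP E.
have := phi2; rewrite -E linearZ /= -E scalerA => /eqP.
by rewrite scaler_eq0 (negPf acm_xi_neq0) orbF mulf_eq0 orbb => /eqP ->;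
  rewrite scale0r.
Qed.

(** Compare the two expansions of phi^3 u. *)
Lemma acm_eta_phi u : eta (phi u) = 0.
Proof.
have := acm_phi2 S (phi u).
rewrite (acm_phi2 S u) linearD linearN linearZ /= acm_phi_xi scaler0 addr0.
rewrite -[LHS]addr0 => /addrI/esym/eqP.
by rewrite scaler_eq0 (negPf acm_xi_neq0) orbF => /eqP.
Qed.

Lemma metric_xi u : g p u xi = eta u.
Proof.
have := acm_metric S u xi; rewrite acm_phi_xi metric0r acm_eta_xi mulr1.
by move/esym/eqP; rewrite subr_eq0 => /eqP.
Qed.

Lemma metric_phi u v : g p (phi u) v = - g p u (phi v).
Proof.
have := acm_metric S (phi u) v; rewrite acm_eta_phi mul0r subr0 => <-.
rewrite (acm_phi2 S u) metricDl metricNl metricZl.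
rewrite (Defs.metric_sym g xi) metric_xi acm_eta_phi.
by rewrite mulr0 addr0.
Qed.

End AlmostContact.

(** * Relations between the three structures; even triples *)

Section Almost3Contact.
Context {R : realType} {n : nat} {M : smooth_manifold R (4 * n + 3)}.
Context {S : almost_3_contact_metric M} {i j k : 'I_3} {p : M}.
Context (ijk : even_triple i j k).
Implicit Types u v : tangent p.
Local Notation g := (a3c_metric S).
Local Notation phi a := (acm_phi (S a) p).
Local Notation xi a := (acm_xi (S a) p).
Local Notation eta a := (acm_eta (S a) p).

Lemma eta_phi_ij u : eta i (phi j u) = eta k u.
Proof. by rewrite (a3c_eta1 S ijk). Qed.

Lemma eta_phi_ji u : eta j (phi i u) = - eta k u.
Proof. by rewrite (a3c_eta2 S ijk) opprK. Qed.

Lemma phi_ij u : phi i (phi j u) = phi k u + eta j u *: xi i.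
Proof. by rewrite (a3c_phi1 S ijk) subrK. Qed.

Lemma phi_ji u : phi j (phi i u) = - phi k u + eta i u *: xi j.
Proof. by rewrite (a3c_phi2 S ijk) opprD opprK subrK. Qed.

End Almost3Contact.

Lemma even_triple_rot (i j k : 'I_3) : even_triple i j k -> even_triple j k i.
Proof.
(* [c * d] is the 3-cycle 0 -> 1 -> 2 -> 0, the left factor acting first. *)
pose c : 'S_3 := tperm 0 1; pose d : 'S_3 := tperm 0 2.
case=> s [es -> -> ->]; exists (c * d * s)%g.
rewrite !odd_permM !odd_tperm /= es; split=> //; rewrite !permM /c /d.
- by rewrite tpermL tpermD.
- by rewrite tpermR tpermL.
- by rewrite [tperm 0 1 _]tpermD ?tpermR.
Qed.

Lemma even_triple_cover (i j k l : 'I_3) :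
  even_triple i j k -> [\/ l = i, l = j | l = k].
Proof.
case=> s [_ -> -> ->]; rewrite -[l](permKV s).
case: ((s^-1)%g l) => [[|[|[|//]]] ltl].
- by constructor 1; congr (s _); apply/val_inj.
- by constructor 2; congr (s _); apply/val_inj.
- by constructor 3; congr (s _); apply/val_inj.
Qed.

Lemma even_triple_exists (i : 'I_3) : exists j k, even_triple i j k.
Proof.
have e012 : even_triple 0 1 2.
  by exists 1%g; rewrite odd_perm1 !perm1.
have e120 := even_triple_rot e012; have e201 := even_triple_rot e120.
case: i => [[|[|[|//]]] lti].
- by exists 1, 2; rewrite (_ : Ordinal _ = 0) //; apply/val_inj.
- by exists 2, 0; rewrite (_ : Ordinal _ = 1) //; apply/val_inj.
- by exists 0, 1; rewrite (_ : Ordinal _ = 2) //; apply/val_inj.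
Qed.

(** * The forms omega_a and the vertical part of N *)

Section Sasaki.
Context {R : realType} {n : nat} {M : smooth_manifold R (4 * n + 3)}.
Context {S : almost_3_contact_metric M} {alpha delta : R}.
Context (sasakiS : alpha_delta_sasaki S alpha delta).
Context {i j k : 'I_3}.
Context (ijk : even_triple i j k).
Implicit Types (X Y Z : vector_field M) (p : M).
Local Notation g := (a3c_metric S).
Local Notation phi a := (acm_phi (S a)).
Local Notation xi a := (acm_xi (S a)).
Local Notation eta a := (acm_eta (S a)).
Local Notation omega a := (ext_deriv (eta a)).
Local Notation J := (endo_app (phi i)).

Let jki := even_triple_rot ijk.
Let kij := even_triple_rot jki.

Lemma metric_phi_phi a b p (u v : tangent p) :
  g p (phi a p u) (phi b p v) = - g p u (phi a p (phi b p v)).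
Proof. exact: metric_phi. Qed.

(** Phi_i is J-invariant, and J rotates the pair (eta_j, eta_k), which preserves its wedge. *)
Lemma omega_i_JJ X Y p : omega i (J X) (J Y) p = omega i X Y p.
Proof.
rewrite !(sasakiS ijk) /fundamental_form /wedge /=.
rewrite metric_phi_phi (acm_phi2 (S i) (Y p)).
rewrite !(eta_phi_ji ijk) !(eta_phi_ij kij) linearD linearN linearZ /=.
rewrite metricDr metricNr metricZr acm_phi_xi.
by rewrite metric0r; ring.
Qed.

(* With omega_jJ_Dk, the real and imaginary parts of the contraction of Omega *)
(* with X + sqrt(-1) J X.                                                     *)
Lemma omega_jB_kJ X Y p :
  omega j X Y p - omega k (J X) Y p = 2 * delta * eta i p (X p) * eta k p (Y p).
Proof.
rewrite (sasakiS jki) (sasakiS kij) /fundamental_form /wedge /=.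
rewrite metric_phi_phi (phi_ji kij) metricDr metricNr metricZr metric_xi.
rewrite acm_eta_phi !(eta_phi_ji ijk).
by ring.
Qed.

Lemma omega_jJ_Dk X Y p :
  omega j (J X) Y p + omega k X Y p =
  - (2 * delta * eta i p (X p) * eta j p (Y p)).
Proof.
rewrite (sasakiS jki) (sasakiS kij) /fundamental_form /wedge /=.
rewrite metric_phi_phi (phi_ij ijk) metricDr metricZr metric_xi.
rewrite acm_eta_phi !(eta_phi_ij kij).
by ring.
Qed.

Lemma form_i_J X : form_app (eta i) (J X) = 0.
Proof. by apply: cinf_eqP => p; exact: acm_eta_phi. Qed.

Lemma form_j_J X : form_app (eta j) (J X) = - form_app (eta k) X.
Proof. by apply: cinf_eqP => p; exact: (eta_phi_ji ijk). Qed.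

Lemma form_k_J X : form_app (eta k) (J X) = form_app (eta j) X.
Proof. by apply: cinf_eqP => p; exact: (eta_phi_ij kij). Qed.

Lemma eta_xi_ij p : eta j p (xi i p) = 0.
Proof. by rewrite (a3c_xi1 S jki) acm_eta_phi. Qed.

Lemma eta_xi_ik p : eta k p (xi i p) = 0.
Proof. by rewrite (a3c_xi2 S jki) linearN /= acm_eta_phi oppr0. Qed.

Lemma eta_i_nijenhuis X Y p : eta i p (nijenhuis (S i) X Y p) = 0.
Proof.
rewrite /nijenhuis !formD !formN formZ !acm_eta_phi acm_eta_xi.
rewrite form_bracket !form_i_J !tangent0 omega_i_JJ.
by ring.
Qed.

(** As theta kills A and B, theta(N) = - theta([A, B]) = Omega(A, B), a multiple of theta(B) = 0.
    This is the real part; [eta_k_nijenhuis] is the imaginary one. *)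
Lemma eta_j_nijenhuis X Y p : eta j p (nijenhuis (S i) X Y p) = 0.
Proof.
rewrite /nijenhuis !formD !formN formZ !(eta_phi_ji ijk) eta_xi_ij.
rewrite (eta_phi_ij kij) !form_bracket !form_j_J !form_k_J !tangentN.
have I1 := omega_jB_kJ X Y p; have I2 := omega_jJ_Dk X (J Y) p.
rewrite /= (eta_phi_ji ijk) in I2.
move/(canRL (subrK _)): I1 => ->; move/(canRL (addrK _)): I2 => ->.
by ring.
Qed.

Lemma eta_k_nijenhuis X Y p : eta k p (nijenhuis (S i) X Y p) = 0.
Proof.
rewrite /nijenhuis !formD !formN formZ !(eta_phi_ij kij) eta_xi_ik.
rewrite (eta_phi_ji ijk) !form_bracket !form_j_J !form_k_J !tangentN.
have I1 := omega_jB_kJ X (J Y) p; have I2 := omega_jJ_Dk X Y p.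
rewrite /= (eta_phi_ij kij) in I1.
move/(canRL (subrK _)): I1 => I1; move/(canRL (addrK _)): I2 => I2.
rewrite (ext_derivC (eta j) X) in I1 *.
by ring: I1 I2.
Qed.

(** The structure equation expresses [omega a] through the values of the fields at p, so pointwise
    antisymmetry of the bracket suffices. *)
Lemma omega_bracketC a X Y Z p :
  omega a (lie_bracket X Y) Z p = - omega a (lie_bracket Y X) Z p.
Proof.
have [b [c abc]] := even_triple_exists a.
rewrite !(sasakiS abc) /fundamental_form /wedge (lie_bracketC X Y).
by rewrite metricNl !formN; ring.
Qed.

(** Re Omega(A, B) = 0, as an identity of functions to be differentiated along Z. *)
Lemma omega_Jl_Jr X Y :
  ext_deriv_fun (eta j) X Y - ext_deriv_fun (eta k) (J X) Y =
  ext_deriv_fun (eta j) (J X) (J Y) + ext_deriv_fun (eta k) X (J Y).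
Proof.
apply: cinf_eqP => p; apply: etrans (omega_jB_kJ X Y p) _.
apply/esym/(etrans (omega_jJ_Dk X (J Y) p)).
by rewrite /= (eta_phi_ji ijk) mulrN opprK.
Qed.

(** * Pairing with a horizontal field Z *)

Section Horizontal.
Context {Z : vector_field M} (Zhor : forall a p, eta a p (Z p) = 0).

Lemma form_horizontal a : form_app (eta a) Z = 0.
Proof. by apply: cinf_eqP => p; exact: Zhor. Qed.

(** Im theta([B, Z]) = 0, because theta kills B and Z, and Omega(B, Z) = 0. *)
Lemma eta_bracket_horizontal Y p :
  eta k p (lie_bracket Y Z p) + eta j p (lie_bracket (J Y) Z p) = 0.
Proof.
rewrite !form_bracket form_j_J !form_horizontal !tangent0 !tangentN.
have := omega_jJ_Dk Y Z p; rewrite Zhor mulr0 oppr0 => /(canRL (addrK _)) ->.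
by ring.
Qed.

(** Re Omega([B, Z], A) = 0: contracting with A leaves a real multiple of Im theta([B, Z]). *)
Lemma omega_bracket_horizontal X Y p :
  omega j (lie_bracket Y Z) X p - omega j (lie_bracket (J Y) Z) (J X) p
  - omega k (lie_bracket Y Z) (J X) p - omega k (lie_bracket (J Y) Z) X p = 0.
Proof.
rewrite !(ext_derivC _ (lie_bracket _ Z)).
have I1 := omega_jB_kJ X (lie_bracket Y Z) p.
have I2 := omega_jJ_Dk X (lie_bracket (J Y) Z) p.
move/(canRL (addKr _)): (eta_bracket_horizontal Y p) => E; rewrite E in I2.
move/(canRL (subrK _)): I1 => ->; move/(canRL (addrK _)): I2 => ->.
by ring.
Qed.

(** With [omega_jJ_horizontal], the two parts of Omega(A, Z) = 0. *)
Lemma omega_j_horizontal X :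
  ext_deriv_fun (eta j) X Z = ext_deriv_fun (eta k) (J X) Z.
Proof.
apply: cinf_eqP => p; rewrite !ext_deriv_funE; apply/eqP.
by rewrite -subr_eq0 omega_jB_kJ Zhor mulr0.
Qed.

Lemma omega_jJ_horizontal X :
  ext_deriv_fun (eta j) (J X) Z = - ext_deriv_fun (eta k) X Z.
Proof.
apply: cinf_eqP => p; apply/eqP.
by rewrite -addr_eq0 !ext_deriv_funE omega_jJ_Dk Zhor mulr0 oppr0.
Qed.

(** The real part of d Omega(A, B, Z) = 0, in which every term but the one with [A, B] vanishes. *)
Lemma omega_bracketJ_horizontal X Y p :
  omega j (lie_bracket X Y) Z p - omega j (lie_bracket (J X) (J Y)) Z p
  - omega k (lie_bracket (J X) Y) Z p - omega k (lie_bracket X (J Y)) Z p = 0.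
Proof.
have C1 := ext_deriv_closed (eta j) X Y Z p.
have C2 := ext_deriv_closed (eta j) (J X) (J Y) Z p.
have C3 := ext_deriv_closed (eta k) (J X) Y Z p.
have C4 := ext_deriv_closed (eta k) X (J Y) Z p.
have := congr1 (Z p) (omega_Jl_Jr X Y).
rewrite !(tangentD _ (ext_deriv_fun _ _ _)) tangentN => E.
have BX := omega_bracket_horizontal Y X p.
have BY := omega_bracket_horizontal X Y p.
rewrite !(ext_deriv_funC _ Z) !tangentN !(omega_bracketC _ Z) in C1 C2 C3 C4.
rewrite !omega_jJ_horizontal !tangentN in C2.
rewrite !omega_j_horizontal in C1.
by lra.
Qed.

Lemma omega_horizontal a X p :
  omega a X Z p = 2 * alpha * g p (X p) (phi a p (Z p)).
Proof.
have [b [c abc]] := even_triple_exists a.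
by rewrite (sasakiS abc) /wedge !Zhor !mulr0 mul0r subrr mulr0 addr0.
Qed.

End Horizontal.

(** Makes N a vector field, so that phi_j N can serve as the test field Z. *)
Lemma nijenhuis_smooth X Y (f : cinf M) :
  (fun p : M => nijenhuis (S i) X Y p f) \in (smooth_fun (M := M)).
Proof.
exact: (valP (lie_derivative (lie_bracket (J X) (J Y)) f
  + lie_derivative (J (J (lie_bracket X Y))) f
  - lie_derivative (J (lie_bracket (J X) Y)) f
  - lie_derivative (J (lie_bracket X (J Y))) f
  + ext_deriv_fun (eta i) X Y * lie_derivative (xi i) f)).
Qed.

(* Z := phi_j N is horizontal and phi_j Z = - N, so testing against Z gives   *)
(* g(N, N) = 0.                                                               *)
Lemma nijenhuis_eq0 X Y p : alpha != 0 -> nijenhuis (S i) X Y p = 0.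
Proof.
move=> alpha0; pose N := VectorField (nijenhuis_smooth X Y).
pose Z := endo_app (phi j) N.
have Nhor l q : eta l q (N q) = 0.
  case: (even_triple_cover l ijk) => ->.
  - exact: eta_i_nijenhuis.
  - exact: eta_j_nijenhuis.
  - exact: eta_k_nijenhuis.
have Zhor l q : eta l q (Z q) = 0.
  case: (even_triple_cover l ijk) => ->; rewrite /Z /=.
  - by rewrite (eta_phi_ij ijk) Nhor.
  - exact: acm_eta_phi.
  - by rewrite (eta_phi_ji jki) Nhor oppr0.
have phi_jZ : phi j p (Z p) = - N p.
  by rewrite acm_phi2 Nhor scale0r addr0.
have phi_kZ : phi k p (Z p) = - phi i p (N p).
  by rewrite (phi_ji jki) Nhor scale0r addr0.
have := omega_bracketJ_horizontal Zhor X Y p.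
rewrite !(omega_horizontal Zhor) phi_jZ phi_kZ !metricNr => E.
have [//|N0] := eqVneq (nijenhuis (S i) X Y p) 0.
have := metric_pos g N0; suff -> : g p (N p) (N p) = 0 by rewrite ltxx.
have NE : N p = nijenhuis (S i) X Y p by [].
(* Unfold only the left argument of g(N, N): as phi_i is skew and eta_i(N) = 0, [E] says that 2
   alpha g(N, N) = 0. *)
move: (N p) (Nhor i p) E NE => w eta_w E NE; rewrite {1}NE /nijenhuis.
rewrite !metricDl !metricNl metricZl !metric_phi acm_phi2 eta_w scale0r addr0.
rewrite (Defs.metric_sym g (xi i p)) metric_xi eta_w !metricNr.
by apply: (mulfI alpha0); lra.
Qed.

End Sasaki.

Theorem theorem2p2p1 (R : realType) (n : nat)
    (M : smooth_manifold R (4 * n + 3)%N) (S : almost_3_contact_metric M)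
    (alpha delta : R) (alpha_neq0 : alpha != 0)
    (HS : alpha_delta_sasaki S alpha delta) :
  hypernormal S.
Proof.
move=> i X Y p; have [j [k ijk]] := even_triple_exists i.
exact: (nijenhuis_eq0 HS ijk X Y p alpha_neq0).
Qed.
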